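(* Let $(X,d)$ be a metric space and let $E$ be a lattice subspace of $F(X)$ containing the constant functions and all the functions $d_x^2$ ($x\in X$). Let $(L_n)_{n\geq 1}$ be a sequence of positive linear operators from $E$ into $F(X)$ and let $Y$ be a subset of $X$ such that (i) $\lim_{n\to\infty}L_n(\mathbf 1)=\mathbf 1$ uniformly on $Y$; (ii) $\lim_{n\to\infty}L_n(d_x^2)(x)=0$ uniformly with respect to $x\in Y$. Then for every $f\in E\cap UC_b(X)$, $\lim_{n\to\infty}L_n(f)=f$ uniformly on $Y$.
   Context: $F(X)$ is the linear space of all real-valued functions on $X$. A linear subspace $E$ of $F(X)$ is a lattice subspace if $|f|\in E$ for every $f\in E$. $UC_b(X)$ is the space of all uniformly continuous bounded real-valued functions on $X$. $\mathbf 1$ is the constant function with value $1$. For $x\in X$, $d_x:X\to\mathbb R$ is $d_x(y):=d(x,y)$, and $d_x^2$ is its square. A linear operator $L:E\to F(X)$ is positive if $L(f)\geq 0$ for every $f\in E$ with $f\geq 0$ (pointwise order). *)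

(* Defs.v *)
From HB Require Import structures.
From mathcomp Require Export all_boot all_order all_algebra.
From mathcomp Require Export all_classical all_reals all_analysis.
Export Order.TTheory GRing.Theory Num.Theory.
Export numFieldNormedType.Exports.

Set Implicit Arguments.
Unset Strict Implicit.
Unset Printing Implicit Defensive.

Local Open Scope classical_set_scope.
Local Open Scope ring_scope.

(* [R^o] makes the function space [X -> R^o] an [lmodType R] for the pointwise
   operations. *)
Definition lattice_subspace (R : realType) (X : Type) (E : set (X -> R^o)) :
    Prop :=
  submod_closed [in E] /\ forall f, f \in E -> (fun x => `|f x|) \in E.

Definition sqdist (R : realType) (X : metricType R) (x : X) : X -> R^o :=
  fun y => mdist x y ^+ 2.

Definition UCb (R : realType) (X : metricType R) : set (X -> R^o) :=
  [set f | unif_continuous f /\ bounded_fun f].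

(* An operator from [E] to the space of all real functions is given by a total
   map [L]; its values outside of [E] are unconstrained. *)
Definition linear_on (R : realType) (X : Type) (E : set (X -> R^o))
    (L : (X -> R^o) -> (X -> R^o)) : Prop :=
  forall (a : R) (f g : X -> R^o), f \in E -> g \in E ->
    L (a *: f + g) = a *: L f + L g.

Definition positive_on (R : realType) (X : Type) (E : set (X -> R^o))
    (L : (X -> R^o) -> (X -> R^o)) : Prop :=
  forall f : X -> R^o, f \in E -> (forall x, 0 <= f x) ->
    forall x, 0 <= L f x.

(* Main.v *)
Require Import Defs.
From mathcomp Require Import ring lra.

Set Implicit Arguments.
Unset Strict Implicit.
Unset Printing Implicit Defensive.

Local Open Scope classical_set_scope.
Local Open Scope ring_scope.

(* For [f] bounded by [M] and uniformly continuous with modulus [delta] for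
   [e], the oscillation satisfies [|f y - f x| <= e + (2 M / delta^2) d(x,y)^2]
   for all [x] and [y]. Applying the positive operator [L n] in the variable
   [y] and evaluating at [x] gives
   [|L n f x - f x * L n 1 x| <= e * L n 1 x + K * L n (d_x^2) x],
   with [K] independent of [x]. *)

(** The entourages of the real line are generated by the relations [ball xy.1 e xy.2], so testing
    these suffices. *)
Lemma uniform_cvg_normP (R : realType) (X : choiceType) (Y : set X)
    (u : nat -> X -> R^o) (f : X -> R^o) :
  {uniform Y, u @ \oo --> f} <->
  forall e : R, 0 < e ->
    \forall n \near \oo, forall x, Y x -> `|f x - u n x| < e.
Proof.
split=> [cvgu e e0|cvgu P].
  apply: (cvgu [set h | forall x, Y x -> `|f x - h x| < e]).
  apply/uniform_nbhs; exists [set xy : R^o * R^o | ball xy.1 e xy.2].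
  by split; first exact: (entourage_ball _ (PosNum e0)).
move/uniform_nbhs => [A [entA subP]].
have [e /= e0 subA] : filter_from [set x | 0 < x]
    (fun e : R => [set xy : R^o * R^o | ball xy.1 e xy.2]) A.
  by rewrite entourage_from_ballE.
apply: filterS (cvgu e e0) => n fu.
by apply: subP => x Yx; apply: subA; exact: fu.
Qed.

Lemma bounded_fun_le (R : realType) (X : Type) (f : X -> R^o) :
  bounded_fun f -> exists2 M, 0 <= M & forall x, `|f x| <= M.
Proof.
(* [bounded_fun] yields a bound only for reals strictly above [M], and [M] may be negative. *)
move=> [M [_ bndf]]; exists (`|M| + 1) => [|x]; first by rewrite addr_ge0.
by apply: (bndf (`|M| + 1)) => //; rewrite (le_lt_trans (ler_norm M))// ltrDl.
Qed.

(** Take [K = 2 * M / d ^+ 2], with [d] the modulus of continuity for [e]. Closer than [d], the term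
    [e] suffices; otherwise [sqdist x y / d ^+ 2] is at least 1 and the trivial bound [2 * M] is
    absorbed. *)
Lemma UCb_le_sqdist (R : realType) (X : metricType R) (f : X -> R^o) (e : R) :
  UCb f -> 0 < e ->
  exists2 K, 0 <= K & forall x y, `|f y - f x| <= e + K * sqdist x y.
Proof.
move=> [ucf /bounded_fun_le[M M_ge0 fM]] e0.
have /ucf : entourage [set xy : R^o * R^o | ball xy.1 e xy.2].
  exact: (entourage_ball _ (PosNum e0)).
rewrite -!entourage_from_ballE => -[d /= d0 fd].
have K_ge0 : 0 <= 2 * M / d ^+ 2 by rewrite divr_ge0 ?sqr_ge0 ?mulr_ge0.
exists (2 * M / d ^+ 2) => // x y.
have [xyd|dxy] := ltP (mdist x y) d.
  have : ball (f x) e (f y) by apply: (fd (x, y)) => /=; rewrite ballEmdist.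
  rewrite -ball_normE/= distrC => /ltW fxy; rewrite (le_trans fxy)// lerDl.
  by rewrite mulr_ge0// sqr_ge0.
have : 2 * M <= 2 * M / d ^+ 2 * sqdist x y.
  rewrite -mulrA ler_peMr ?mulr_ge0// mulrC ler_pdivlMr ?exprn_gt0// mul1r.
  by rewrite /sqdist lerXn2r ?nnegrE// ltW// (lt_le_trans d0).
have := ler_normB (f y) (f x); have := fM x; have := fM y; lra.
Qed.

Lemma positive_linear_dist_le (R : realType) (X : Type) (E : set (X -> R^o))
    (T : (X -> R^o) -> (X -> R^o)) (f g : X -> R^o) (c e K : R) (x : X) :
  submod_closed [in E] -> linear_on E T -> positive_on E T ->
  f \in E -> g \in E -> (cst 1 : X -> R^o) \in E ->
  (forall y, `|f y - c| <= e + K * g y) ->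
  `|T f x - c * T (cst 1) x| <= e * T (cst 1) x + K * T g x.
Proof.
move=> [E0 ES] linT posT fE gE oneE fcg.
(* Both halves of the absolute value are instances of one positivity statement, with sign [s = 1] or
   [s = -1]. *)
have T_ge0 (s : R) : (forall y, 0 <= s * (f y - c) + (e + K * g y)) ->
    0 <= s * (T f x - c * T (cst 1) x) + (e * T (cst 1) x + K * T g x).
  move=> s_ge0.
  have ZE (a : R) h : h \in E -> a *: h \in E.
    by move=> hE; rewrite -[a *: h]addr0; exact: ES.
  have KgE := ZE K _ gE.
  have T0 : T 0 = 0.
    have := linT 1 0 0 E0 E0.
    by rewrite !scale1r addr0 => /esym/eqP; rewrite -subr_eq0 addrK => /eqP.
  have TKg : T (K *: g) = K *: T g.
    by rewrite -[K *: g]addr0 linT// T0 addr0.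
  (* The function is regrouped as [s *: f + ((e - s * c) *: cst 1 + K *: g)], a nested combination
     of the form required by [linear_on]. *)
  have oneKgE := ES (e - s * c) _ _ oneE KgE.
  have := posT _ (ES s _ _ fE oneKgE) _ x.
  rewrite !linT// TKg => /(_ _)/le_trans; apply => [y|].
    apply: le_trans (s_ge0 y) _.
    by rewrite !fctE/= /GRing.scale/=; lra.
  by rewrite !fctE/= /GRing.scale/=; lra.
rewrite ler_norml; apply/andP; split.
  have := T_ge0 1; rewrite mul1r => H.
  rewrite -subr_ge0 opprK H// => y.
  by have := fcg y; rewrite ler_norml => /andP[]; lra.
have := T_ge0 (-1); rewrite mulN1r => H.
rewrite -subr_ge0 addrC H// => y.
by have := fcg y; rewrite ler_norml => /andP[]; lra.
Qed.

Theorem theorem3p2 (R : realType) (X : metricType R) (E : set (X -> R^o))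
    (L : nat -> (X -> R^o) -> (X -> R^o)) (Y : set X)
    (lattE : lattice_subspace E)
    (cstE : forall c : R, (cst c : X -> R^o) \in E)
    (sqdistE : forall x : X, sqdist x \in E)
    (linL : forall n, (1 <= n)%N -> linear_on E (L n))
    (posL : forall n, (1 <= n)%N -> positive_on E (L n))
    (L1 : {uniform Y, (fun n => L n (cst 1)) @ \oo --> (cst 1 : X -> R^o)})
    (Lsqdist : {uniform Y,
      (fun n x => L n (sqdist x) x) @ \oo --> (cst 0 : X -> R^o)}) :
  forall f : X -> R^o, f \in E `&` @UCb R X ->
    {uniform Y, (fun n => L n f) @ \oo --> f}.
Proof.
move=> f /set_mem[/mem_set fE ucbf]; apply/uniform_cvg_normP => e e0.
have [submodE _] := lattE.
have e4 : 0 < e / 4 by rewrite divr_gt0.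
have [K K0 fK] := UCb_le_sqdist ucbf e4.
have [_ /bounded_fun_le[M M_ge0 fM]] := ucbf.
(* [M] and [K] may vanish, so the divisions below use [M + 1] and [K + 1]. *)
have M1 : 0 < M + 1 by rewrite ltr_wpDl.
have K1 : 0 < K + 1 by rewrite ltr_wpDl.
(* The 1 in the minimum ensures [L n (cst 1) x < 2]; the other term makes
   [f x * (1 - L n (cst 1) x)] smaller than [e / 4]. *)
pose eta := Num.min 1 (e / 4 / (M + 1)).
have eta0 : 0 < eta by rewrite lt_min ltr01 divr_gt0.
move/uniform_cvg_normP/(_ _ eta0) : L1 => L1.
move/uniform_cvg_normP/(_ _ (divr_gt0 e4 K1)) : Lsqdist => Lsq.
apply: filterS3 (nbhs_infty_ge 1) L1 Lsq => n n1 L1n Lsqn x Yx.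
have := L1n x Yx; rewrite /= lt_min => /andP[L1x1 L1xM].
have /= Lsqx := Lsqn x Yx.
(* Here [c] is [f x]: the point [x] is both the centre of [sqdist x] and the point of evaluation. *)
have := positive_linear_dist_le x submodE (linL _ n1) (posL _ n1) fE (sqdistE x)
  (cstE 1) (fK x).
set l1 := L n (cst 1) x in L1x1 L1xM *.
set ld := L n (sqdist x) x in Lsqx *.
move=> Lfx.
have l1_le2 : e / 4 * l1 <= e / 4 * 2.
  by rewrite ler_pM2l//; move: L1x1; rewrite ltr_norml => /andP[]; lra.
have Kld : K * ld < e / 4.
  apply: (@le_lt_trans _ _ (K * `|0 - ld|)).
    by rewrite ler_wpM2l// sub0r normrN ler_norm.
  apply: (@le_lt_trans _ _ ((K + 1) * `|0 - ld|)).
    by rewrite ler_wpM2r// lerDl.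
  by rewrite mulrC -ltr_pdivlMr.
have fl1 : `|f x * (1 - l1)| < e / 4.
  rewrite normrM (@le_lt_trans _ _ ((M + 1) * `|1 - l1|))//.
    by rewrite ler_wpM2r// (le_trans (fM x))// lerDl.
  by rewrite mulrC -ltr_pdivlMr.
rewrite distrC.
(* The first term is below [e / 2 + e / 4], the second below [e / 4]. *)
have -> : L n f x - f x = (L n f x - f x * l1) - f x * (1 - l1) by ring.
have := ler_normB (L n f x - f x * l1) (f x * (1 - l1)); lra.
Qed.
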